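(* Let $\Omega\in\mathbb{R}^{n\times k}$ be an $(s,\alpha,\rho)$-OSI. Then, for every $0<\tau<1-\rho$, $\Omega$ is an \[ \left(s,\ \alpha,\ \alpha+\frac{s(1-\alpha+\alpha\rho)}{\tau},\ \rho+\tau\right)\text{-OSE}. \]
   Context: Definition (oblivious subspace injection, OSI). Fix integers $1\le s\le n$ and $k\ge1$, an injectivity parameter $\alpha\in(0,1]$, and a failure parameter $\rho\in[0,1)$. A random matrix $\Omega\in\mathbb{R}^{n\times k}$ is an $(s,\alpha,\rho)$-OSI if (i) (isotropy) $\mathbb{E}[\Omega\Omega^\top]=I_n$; and (ii) (injectivity) for every fixed $s$-dimensional subspace $V\subseteq\mathbb{R}^n$, $\mathbb{P}\{\|\Omega^\top x\|_2^2\ge\alpha\|x\|_2^2\text{ for all }x\in V\}\ge1-\rho$. Definition (oblivious subspace embedding, OSE). Fix integers $1\le s\le n$ and $k\ge1$, embedding parameters $\alpha\in(0,1]$ and $\beta\ge1$, and a failure parameter $\rho\in[0,1)$. A random matrix $\Omega\in\mathbb{R}^{n\times k}$ is an $(s,\alpha,\beta,\rho)$-OSE if, for every $s$-dimensional subspace $V\subseteq\mathbb{R}^n$, $\mathbb{P}\{\alpha\|x\|_2^2\le\|\Omega^\top x\|_2^2\le\beta\|x\|_2^2\text{ for all }x\in V\}\ge1-\rho$. *)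

(* Defs.v *)
From HB Require Import structures.
From mathcomp Require Import all_boot all_order all_algebra.
From mathcomp Require Import all_classical all_reals all_analysis.

Set Implicit Arguments.
Unset Strict Implicit.
Unset Printing Implicit Defensive.

Import Order.TTheory GRing.Theory Num.Theory.

Local Open Scope classical_set_scope.
Local Open Scope ring_scope.

(* The norm that MathComp-Analysis puts on matrices is the sup norm, so the
   Euclidean norm is defined here. *)
Definition norm2 (R : realType) (m : nat) (x : 'cV[R]_m) : R :=
  Num.sqrt (\sum_(i < m) x i 0 ^+ 2).

(* A random matrix is a matrix of real random variables; [sample Omega t] is
   its realization at the outcome [t]. *)
Definition sample d (T : measurableType d) (R : realType)
    (P : probability T R) (n k : nat) (Omega : 'M[{RV P >-> R}]_(n, k))
    (t : T) : 'M[R]_(n, k) :=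
  \matrix_(i, j) (Omega i j : T -> R) t.

(* The expectation is extended-real valued and takes a finite value on a
   measurable function only if that function is integrable, so the equations
   below include the existence of the expectation of every entry. *)
Definition isotropic d (T : measurableType d) (R : realType)
    (P : probability T R) (n k : nat) (Omega : 'M[{RV P >-> R}]_(n, k)) : Prop :=
  forall i j : 'I_n,
    ('E_P[fun t => (sample Omega t *m (sample Omega t)^T) i j] =
     ((1%:M : 'M[R]_n) i j)%:E)%E.

Record is_OSI d (T : measurableType d) (R : realType) (P : probability T R)
    (n k s : nat) (alpha rho : R) (Omega : 'M[{RV P >-> R}]_(n, k)) : Prop :=
  IsOSI {
    OSI_s : (1 <= s <= n)%N;
    OSI_k : (1 <= k)%N;
    OSI_alpha : 0 < alpha <= 1;
    OSI_rho : 0 <= rho < 1;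
    OSI_isotropy : isotropic Omega;
    OSI_injectivity : forall V : {vspace 'cV[R]_n}, \dim V = s ->
      ((1 - rho)%:E <=
       P [set t | forall x : 'cV[R]_n, x \in V ->
            (alpha * norm2 x ^+ 2 <= norm2 ((sample Omega t)^T *m x) ^+ 2)%R])%E
  }.

Record is_OSE d (T : measurableType d) (R : realType) (P : probability T R)
    (n k s : nat) (alpha beta rho : R) (Omega : 'M[{RV P >-> R}]_(n, k)) : Prop :=
  IsOSE {
    OSE_s : (1 <= s <= n)%N;
    OSE_k : (1 <= k)%N;
    OSE_alpha : 0 < alpha <= 1;
    OSE_beta : 1 <= beta;
    OSE_rho : 0 <= rho < 1;
    OSE_embedding : forall V : {vspace 'cV[R]_n}, \dim V = s ->
      ((1 - rho)%:E <=
       P [set t | forall x : 'cV[R]_n, x \in V ->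
            (alpha * norm2 x ^+ 2 <= norm2 ((sample Omega t)^T *m x) ^+ 2
              <= beta * norm2 x ^+ 2)%R])%E
  }.

(* Main.v *)
(* Compress to the subspace: if the columns of [U] form an orthonormal basis of
   [V], put [M = U^T Omega Omega^T U], so that [E tr M = s].  On the injectivity
   event [G], [M - alpha I] is positive semidefinite, hence its largest
   eigenvalue is at most [tr M - s alpha], which is nonnegative on [G].  Since
   [tr M >= 0] off [G], the expectation of [tr M - s alpha] over [G] is at most
   [s - s alpha (1 - rho)], and Markov's inequality on [G] concludes. *)
Require Import Defs.
From mathcomp Require Import all_boot all_order all_algebra.
From mathcomp Require Import all_classical all_reals all_analysis.
From mathcomp Require Import measurable_realfun.
From mathcomp Require Import ring lra.

Set Implicit Arguments.
Unset Strict Implicit.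
Unset Printing Implicit Defensive.

Import Order.TTheory GRing.Theory Num.Theory.
Import numFieldNormedType.Exports.

Local Open Scope ring_scope.

(** * Quadratic forms and positive semidefinite matrices *)

Definition quad (R : realType) m (A : 'M[R]_m) (y : 'cV[R]_m) : R :=
  (y^T *m A *m y) 0 0.

Lemma norm2_sqr (R : realType) m (x : 'cV[R]_m) : norm2 x ^+ 2 = (x^T *m x) 0 0.
Proof.
rewrite /norm2 sqr_sqrtr; last by apply: sumr_ge0 => i _; exact: sqr_ge0.
by rewrite mxE; apply: eq_bigr => i _; rewrite mxE expr2.
Qed.

Lemma trmx_mulmx_ge0 (R : realType) m (x : 'cV[R]_m) : 0 <= (x^T *m x) 0 0.
Proof. by rewrite -norm2_sqr sqr_ge0. Qed.

Lemma trmx_mulmx_eq0 (R : realType) m (x : 'cV[R]_m) :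
  ((x^T *m x) 0 0 == 0) = (x == 0).
Proof.
apply/eqP/eqP => [|->]; last by rewrite mulmx0 mxE.
rewrite mxE => /eqP; rewrite psumr_eq0; last first.
  by move=> i _; rewrite mxE -expr2 sqr_ge0.
move=> /allP h; apply/matrixP => i j; rewrite ord1 mxE.
have := h i (mem_index_enum i); rewrite implyTb mxE -expr2 sqrf_eq0.
by move/eqP.
Qed.

Lemma quadE (R : realType) m (A : 'M[R]_m) y :
  quad A y = \sum_i \sum_j A i j * (y i 0 * y j 0).
Proof.
rewrite /quad mxE exchange_big /=; apply: eq_bigr => j _.
rewrite mxE mulr_suml; apply: eq_bigr => i _.
by rewrite mxE; ring.
Qed.

Lemma quadD (R : realType) m (A B : 'M[R]_m) y :
  quad (A + B) y = quad A y + quad B y.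
Proof. by rewrite /quad mulmxDr mulmxDl mxE. Qed.

Lemma quadN (R : realType) m (A : 'M[R]_m) y : quad (- A) y = - quad A y.
Proof. by rewrite /quad mulmxN mulNmx mxE. Qed.

Lemma quad_scalar (R : realType) m (a : R) (y : 'cV[R]_m) :
  quad a%:M y = a * (y^T *m y) 0 0.
Proof. by rewrite /quad mul_mx_scalar -scalemxAl mxE. Qed.

(* Apply positivity to the columns of the projection-like matrix
   [Q = |y|^2 I - y y^T], which satisfies [Q Q = |y|^2 Q]. *)
Lemma psd_quad_le_trace (R : realType) m (A : 'M[R]_m) :
  (forall y, 0 <= quad A y) -> forall y, quad A y <= \tr A * (y^T *m y) 0 0.
Proof.
move=> A0 y; have [->|y0] := eqVneq y 0.
  by rewrite /quad !mulmx0 mxE mulr0.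
set r := (y^T *m y) 0 0.
have r0 : 0 < r by rewrite lt_def trmx_mulmx_eq0 y0 trmx_mulmx_ge0.
pose Q : 'M[R]_m := r%:M - y *m y^T.
have yy : y^T *m y = r%:M by rewrite [LHS]mx11_scalar.
have QQ : Q *m Q = r *: Q.
  rewrite /Q mulmxBl !mul_scalar_mx mulmxBr mul_mx_scalar.
  by rewrite -mulmxA (mulmxA y^T) yy mul_scalar_mx scalemxAr subrr subr0.
have QT : Q^T = Q by rewrite /Q linearB /= tr_scalar_mx trmx_mul trmxK.
have : 0 <= \tr (Q *m A *m Q).
  apply: sumr_ge0 => i _.
  suff -> : (Q *m A *m Q) i i = quad A (col i Q) by exact: A0.
  rewrite /quad tr_col QT -row_mul [LHS]mxE [RHS]mxE.
  by apply: eq_bigr => j _; rewrite !mxE.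
(* Cyclicity and [Q *m Q = r *: Q] turn the trace into [r * \tr (Q *m A)], and [\tr (Q *m A)]
   expands to [r * \tr A - quad A y]. *)
rewrite mxtrace_mulC mulmxA QQ -scalemxAl mxtraceZ pmulr_rge0 // /Q.
rewrite mulmxBl raddfB /= mul_scalar_mx mxtraceZ subr_ge0 mulrC.
rewrite -mulmxA mxtrace_mulC /quad.
by rewrite [X in \tr X]mx11_scalar mxtrace_scalar mulr1n.
Qed.

(** * Orthonormal bases of subspaces *)

(** One Gram-Schmidt step: a dimension count yields [v] in [V] outside the column span of [U];
    subtracting its projection [U *m (U^T *m v)] and normalizing gives [w]. *)
Lemma orthonormal_extend (R : realType) n m (V : {vspace 'cV[R]_n})
    (U : 'M[R]_(n, m)) :
  (m < \dim V)%N -> U^T *m U = 1%:M -> (forall y, U *m y \in V) ->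
  exists2 w : 'cV[R]_n, w \in V & (row_mx U w)^T *m row_mx U w = 1%:M.
Proof.
move=> mV UU UV; pose W := limg (linfun (mulmx U : 'cV[R]_m -> 'cV[R]_n)).
have /subvPn[v vV vW] : ~~ (V <= W)%VS.
  apply: contraL mV => /dimvS VW; rewrite -leqNgt (leq_trans VW) //.
  rewrite -[leqRHS](_ : \dim {:'cV[R]_m} = m); last first.
    by rewrite dimvf /dim /= muln1.
  by rewrite -(limg_ker_dim (linfun (mulmx U : 'cV[R]_m -> 'cV[R]_n))) leq_addl.
pose w := v - U *m (U^T *m v).
have w0 : w != 0.
  apply: contra vW; rewrite subr_eq0 => /eqP ->.
  have -> : U *m (U^T *m v) =
      linfun (mulmx U : 'cV[R]_m -> 'cV[R]_n) (U^T *m v).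
    by rewrite lfunE.
  by rewrite memv_img ?memvf.
have wV : w \in V by rewrite rpredB.
have Uw : U^T *m w = 0 by rewrite mulmxBr (mulmxA U^T) UU mul1mx subrr.
pose r := (w^T *m w) 0 0.
have r0 : 0 < r by rewrite lt_def trmx_mulmx_eq0 w0 trmx_mulmx_ge0.
exists ((Num.sqrt r)^-1 *: w); first by rewrite rpredZ.
rewrite tr_row_mx mul_col_row UU [(_ *: w)^T]linearZ /= -!scalemxAr.
rewrite -!scalemxAl Uw scaler0.
rewrite -[w^T *m U]trmxK trmx_mul trmxK Uw trmx0 scaler0 scalerA.
rewrite [w^T *m w]mx11_scalar -/r scale_scalar_mx -expr2 exprVn.
rewrite sqr_sqrtr ?ltW //.
by rewrite mulVf ?gt_eqF // -scalar_mx_block.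
Qed.

(** The empty family is extended until it has [\dim V] columns. Since [U^T *m U = 1%:M] makes [U]
    injective, its range then has the dimension of [V] and fills it. *)
Lemma orthonormal_basis (R : realType) n (V : {vspace 'cV[R]_n}) :
  exists2 U : 'M[R]_(n, \dim V), U^T *m U = 1%:M &
    forall x, x \in V <-> exists y, x = U *m y.
Proof.
have family m : (m <= \dim V)%N -> exists2 U : 'M[R]_(n, m), U^T *m U = 1%:M &
    forall y, U *m y \in V.
  elim: m => [|m IH] mV.
    exists 0 => [|y]; first by apply/matrixP => -[].
    by rewrite mul0mx mem0v.
  have [U UU UV] := IH (ltnW mV).
  have [w wV ww] := orthonormal_extend mV UU UV.
  rewrite -addn1; exists (row_mx U w) => // y.
  rewrite -[y]vsubmxK mul_row_col rpredD //.
  by rewrite [X in w *m X]mx11_scalar mul_mx_scalar rpredZ.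
have [U UU UV] := family _ (leqnn _).
exists U => // x; split=> [xV|[y ->]] //.
pose f := linfun (mulmx U : 'cV[R]_(\dim V) -> 'cV[R]_n).
have fE y : f y = U *m y by rewrite lfunE.
suff /eqP WV : V == limg f.
  by move: xV; rewrite {1}WV => /memv_imgP[y _ ->]; exists y; rewrite fE.
rewrite eq_sym eqEdim; apply/andP; split.
  by apply/subvP => _ /memv_imgP[y _ ->]; rewrite fE.
rewrite limg_dim_eq; first by rewrite dimvf /dim /= muln1.
apply/eqP; rewrite -subv0 capfv; apply/subvP => y; rewrite memv_ker fE memv0.
by move=> /eqP Uy; rewrite -[y]mul1mx -UU -mulmxA Uy mulmx0.
Qed.

(** * Measurability of positive semidefiniteness *)

Local Open Scope classical_set_scope.

Lemma cvg_add_harmonic (R : archiRealFieldType) (x : R) :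
  x + harmonic k @[k --> \oo] --> x.
Proof.
rewrite -[X in _ --> X]addr0; apply: cvgD; first exact: cvg_cst.
exact: cvg_harmonic.
Qed.

(** Rational vectors are dense and the form is continuous. This replaces an uncountable family of
    conditions by a countable one. *)
Lemma psd_from_rat (R : realType) m (A : 'M[R]_m) :
  (forall q : {ffun 'I_m -> rat}, 0 <= quad A (\col_i ratr (q i))) ->
  forall y, 0 <= quad A y.
Proof.
move=> A0 y.
(* Each coordinate is approximated from above by a rational within [harmonic k], that is,
   1/(k+1). *)
have /choice[q qP] (p : 'I_m * nat) :
    exists q : rat, y p.1 0 < ratr q < y p.1 0 + harmonic p.2.
  have /rat_in_itvoo[q] : y p.1 0 < y p.1 0 + harmonic p.2.
    by rewrite ltrDl harmonic_gt0.
  by rewrite in_itv /=; exists q.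
have qy i : ratr (q (i, k)) @[k --> \oo] --> y i 0.
  apply: (@squeeze_cvgr _ _ _ _ (fun=> y i 0) (fun k => y i 0 + harmonic k)).
  - by apply: nearW => k; have /andP[/ltW -> /ltW ->] := qP (i, k).
  - exact: cvg_cst.
  - exact: cvg_add_harmonic.
have Ay : quad A (\col_i ratr (q (i, k))) @[k --> \oo] --> quad A y.
  under eq_fun do rewrite quadE.
  rewrite quadE; apply: cvg_big => [|i _]; first exact: add_continuous.
  apply: cvg_big => [|j _]; first exact: add_continuous.
  under eq_fun do rewrite !mxE.
  by apply: cvgM; [exact: cvg_cst|exact: cvgM].
rewrite -(cvg_lim _ Ay) //.
apply: limr_ge; first by apply/cvg_ex; exists (quad A y).
apply: nearW => k; have := A0 [ffun i => q (i, k)].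
by congr (0 <= quad A _); apply/matrixP => i j; rewrite !mxE ffunE.
Qed.

Lemma measurable_psd d (T : measurableType d) (R : realType) m
    (A : T -> 'M[R]_m) :
  (forall i j, measurable_fun setT (fun t => A t i j)) ->
  measurable [set t | forall y, 0 <= quad (A t) y].
Proof.
move=> mA.
rewrite (_ : mkset _ = ~` \bigcup_(q : {ffun 'I_m -> rat})
   ~` [set t | 0 <= quad (A t) (\col_i ratr (q i))]); last first.
  rewrite setC_bigcup; apply/seteqP; split=> t /= At.
    by move=> q _; rewrite setCK; exact: At.
  by apply: psd_from_rat => q; have := At q I; rewrite setCK.
apply: measurableC; apply: countable_bigcupT_measurable => [|q].
  exact: countableP.
apply: measurableC; rewrite -[X in measurable X]setTI.
apply: measurable_fun_le => //.
under eq_fun do rewrite quadE.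
apply: measurable_sum => i; apply: measurable_sum => j.
by apply: measurable_funM => //; exact: measurable_cst.
Qed.

(** * Markov's inequality on an event *)

Lemma expectation_ge_indic2 d (T : measurableType d) (R : realType)
    (P : probability T R) (G B : set T) (Z : T -> R) (a b : R) :
  measurable G -> measurable B -> measurable_fun setT Z -> 0 <= a -> 0 <= b ->
  (forall t, a * \1_G t + b * \1_B t <= Z t) ->
  (a%:E * P G + b%:E * P B <= \int[P]_t (Z t)%:E)%E.
Proof.
move=> mG mB mZ a0 b0 abZ.
have ind0 (A : set T) t : (0 <= (\1_A t : R)%:E)%E by rewrite lee_fin.
have mind (A : set T) : measurable A ->
    measurable_fun setT (fun t => (\1_A t : R)%:E).
  by move=> mA; apply/measurable_EFinP; exact/measurable_indicP.
have intI (A : set T) c : measurable A -> 0 <= c ->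
    (\int[P]_t (c%:E * (\1_A t)%:E) = c%:E * P A)%E.
  move=> mA c0; rewrite ge0_integralZl_EFin //; last exact: mind.
  by rewrite integral_indic // setIT.
rewrite -!intI // -ge0_integralD //.
- apply: ge0_le_integral => //.
  + by move=> t _; rewrite adde_ge0 ?mule_ge0 ?lee_fin.
  + by apply: emeasurable_funD; apply: emeasurable_funM => //; exact: mind.
  + exact/measurable_EFinP.
  + by move=> t _; rewrite -!EFinM -EFinD lee_fin.
- by move=> t _; rewrite mule_ge0 ?lee_fin.
- by apply: emeasurable_funM => //; exact: mind.
- by move=> t _; rewrite mule_ge0 ?lee_fin.
- by apply: emeasurable_funM => //; exact: mind.
Qed.

(** Let [B] be the part of [G] where [Z] exceeds [a + b + e]. Then [Z] dominates [a] on [G], a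
    further [b + e] on [B], and [0] off [G]. Integrating, with [P G] at least [1 - rho], leaves at
    most [b * tau] for [(b + e) * P B], so removing [B] from [G] costs at most [tau]. *)
Lemma markov_on_event d (T : measurableType d) (R : realType)
    (P : probability T R) (G : set T) (Z : T -> R) (E a b rho tau : R) :
  measurable G -> measurable_fun setT Z -> (forall t, 0 <= Z t) ->
  (\int[P]_t (Z t)%:E = E%:E)%E ->
  (forall t, G t -> a <= Z t) -> 0 <= a -> 0 <= b -> 0 < tau ->
  ((1 - rho)%:E <= P G)%E -> E - a * (1 - rho) <= b * tau ->
  ((1 - (rho + tau))%:E <= P (G `&` [set t | Z t <= a + b]%R))%E.
Proof.
move=> mG mZ Z0 EZ aZ a0 b0 tau0 PG Eab.
have mle c : measurable [set t | Z t <= c].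
  by rewrite -[X in measurable X]setTI; apply: measurable_fun_le => //.
(* The slack [e] avoids a separate treatment of [b = 0]. *)
have strict (e : R) : 0 < e ->
    ((1 - (rho + tau))%:E <= P (G `&` [set t | Z t <= a + b + e]%R))%E.
  move=> e0; set C := [set t | _].
  have mC : measurable C by exact: mle.
  have mB : measurable (G `\` C) by exact: measurableD.
  have := @expectation_ge_indic2 _ _ _ P G (G `\` C) Z a (b + e) mG mB mZ a0
    (addr_ge0 b0 (ltW e0)).
  move: PG; have -> : P G = (P (G `\` C) + P (G `&` C))%E by rewrite -measureDI.
  have mI : measurable (G `&` C) by exact: measurableI.
  rewrite -[P (G `\` C)]fineK ?fin_num_measure //.
  rewrite -[P (G `&` C)]fineK ?fin_num_measure //.
  set p := fine _; set q := fine _.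
  rewrite EZ -!EFinD !lee_fin => pq aZE.
  (* Here [p] and [q] are the probabilities of the parts of [G] outside and inside [C]. As [p + q]
     is at least [1 - rho], the goal reduces to [p <= tau]. *)
  suff pqE : a * (p + q) + (b + e) * p <= E.
    have apq : 0 <= a * (p + q - (1 - rho)) by rewrite mulr_ge0 // subr_ge0.
    have : p <= tau; last by lra.
    rewrite leNgt; apply/negP => ptau.
    have : 0 <= b * (p - tau) by rewrite mulr_ge0 // subr_ge0 ltW.
    have : 0 < e * p by rewrite mulr_gt0 // (lt_trans tau0).
    lra.
  apply: aZE => t; rewrite !indicE.
  have [tG|tG] := boolP (t \in G); last first.
    by rewrite in_setD (negbTE tG) /= !mulr0 addr0.
  rewrite in_setD tG /= mulr1; have [tC|tC] := boolP (t \in C).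
    by rewrite mulr0 addr0; apply: aZ; exact/set_mem.
  rewrite mulr1 addrA leNgt; apply: contra tC => ?; apply/mem_set.
  exact: ltW.
(* The slack is removed along [e = harmonic k]: the events decrease to the target, so continuity of
   [P] from above preserves the bound. *)
have -> : G `&` [set t | Z t <= a + b] =
    \bigcap_k (G `&` [set t | Z t <= a + b + harmonic k]).
  apply/seteqP; split=> t /=.
    move=> [Gt Zt] k _; split=> //=.
    by rewrite (le_trans Zt) // lerDl harmonic_ge0.
  move=> Ht; split; first by have [] := Ht 0%N I.
  rewrite -(cvg_lim _ (@cvg_add_harmonic R (a + b))) //.
  apply: limr_ge.
    by apply/cvg_ex; exists (a + b); exact: cvg_add_harmonic.
  by apply: nearW => k; have [] := Ht k I.
have mF k : measurable (G `&` [set t | Z t <= a + b + harmonic k]).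
  exact: measurableI.
apply: cvge_ge (nonincreasing_cvg_mu _ mF _ _).
- by apply: nearW => k; apply: strict; exact: harmonic_gt0.
- by rewrite (le_lt_trans (probability_le1 _ _)) // ltry.
- exact: bigcapT_measurable.
- move=> k l kl; apply/subsetPset => t /= [Gt Zt]; split => //.
  rewrite (le_trans Zt) // lerD2l /harmonic /= lef_pV2 ?posrE ?ltr0n //.
  by rewrite ler_nat ltnS.
Qed.

(** * Expectation of a trace *)

Lemma integral_mxtraceM d (T : measurableType d) (R : realType)
    (P : probability T R) n (K : T -> 'M[R]_n) (A B : 'M[R]_n) :
  (forall i j, measurable_fun setT (fun t => K t i j)) ->
  (forall i j, (\int[P]_t (K t i j)%:E = (A i j)%:E)%E) ->
  (\int[P]_t (\tr (K t *m B))%:E = (\tr (A *m B))%:E)%E.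
Proof.
move=> mK KA.
have trE (M : 'M[R]_n) : (\tr (M *m B))%:E =
    (\sum_i \sum_j (B j i)%:E * (M i j)%:E)%E.
  rewrite /mxtrace -sumEFin; apply: eq_bigr => i _.
  by rewrite mxE -sumEFin; apply: eq_bigr => j _; rewrite mulrC EFinM.
(* A measurable function with a finite integral is integrable, which is what linearity of the
   integral requires below. *)
have iK i j : P.-integrable setT (fun t => (K t i j)%:E).
  apply/integrableP; split; first exact/measurable_EFinP.
  by rewrite integral_fin_num_abs // KA.
have iBK i j : P.-integrable setT (fun t => ((B j i)%:E * (K t i j)%:E)%E).
  exact: integrableZl.
under eq_integral do rewrite trE.
rewrite trE integral_sum // => [|i]; last exact: integrable_sum.
apply: eq_bigr => i _; rewrite integral_sum //; apply: eq_bigr => j _.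
by rewrite integralZl // KA.
Qed.

(** * Compression to a subspace and the embedding property *)

Theorem proposition2p1 (d : measure_display) (T : measurableType d)
    (R : realType) (P : probability T R) (n k s : nat) (alpha rho : R)
    (Omega : 'M[{RV P >-> R}]_(n, k)) (hOSI : is_OSI s alpha rho Omega)
    (tau : R) (htau : 0 < tau < 1 - rho) :
  is_OSE s alpha (alpha + s%:R * (1 - alpha + alpha * rho) / tau) (rho + tau)
    Omega.
Proof.
case: hOSI => sn k1 alpha01 rho01 iso inj.
have [[alpha0 alpha1] [rho0 rho1] [tau0 taurho]] :
  [/\ 0 < alpha /\ alpha <= 1, 0 <= rho /\ rho < 1 & 0 < tau /\ tau < 1 - rho].
  by split; apply/andP.
set c := s%:R * _.
have s1 : 1 <= s%:R :> R by rewrite ler1n; case/andP: sn.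
(* With [1 <= s] and [tau < 1], this bound leads to [ctau], which gives both [1 <= alpha + c / tau],
   required of an upper embedding parameter, and [0 <= c / tau]. *)
have c0 : 1 - alpha <= c.
  have h : 0 <= 1 - alpha + alpha * rho.
    by rewrite addr_ge0 ?mulr_ge0 ?subr_ge0 // ltW.
  apply: (@le_trans _ _ (1 - alpha + alpha * rho)); last by rewrite ler_peMl.
  by rewrite lerDl mulr_ge0 // ltW.
have ctau : 1 - alpha <= c / tau.
  by rewrite ler_pdivlMr // (le_trans _ c0) // ler_piMr ?subr_ge0 //; lra.
split=> //; [by rewrite -lerBlDl | by apply/andP; split; lra | move=> V dV].
have := orthonormal_basis V; rewrite dV => -[U UU UV].
pose K t := sample Omega t *m (sample Omega t)^T.
pose M t := U^T *m K t *m U.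
have normU y : norm2 (U *m y) ^+ 2 = (y^T *m y) 0 0.
  by rewrite norm2_sqr trmx_mul -mulmxA (mulmxA U^T) UU mul1mx.
have normOU t y : norm2 ((sample Omega t)^T *m (U *m y)) ^+ 2 = quad (M t) y.
  by rewrite norm2_sqr /quad /M /K !trmx_mul trmxK !mulmxA.
have mK i j : measurable_fun setT (fun t => K t i j).
  under eq_fun do rewrite mxE; apply: measurable_sum => l.
  by under eq_fun do rewrite !mxE; exact: measurable_funM.
have mM i j : measurable_fun setT (fun t => M t i j).
  under eq_fun do rewrite mxE; apply: measurable_sum => l.
  apply: measurable_funM; last exact: measurable_cst.
  under eq_fun do rewrite mxE; apply: measurable_sum => l'.
  by apply: measurable_funM => //; exact: measurable_cst.
have mtrM : measurable_fun setT (fun t => \tr (M t)) by exact: measurable_sum.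
have EtrM : (\int[P]_t (\tr (M t))%:E = s%:R%:E)%E.
  (* By cyclicity the trace is that of [K t *m (U *m U^T)]; isotropy replaces [K t] by the identity,
     and the trace of [U *m U^T] equals that of [U^T *m U = 1%:M]. *)
  under eq_integral do rewrite /M -mulmxA mxtrace_mulC -mulmxA.
  rewrite (@integral_mxtraceM _ _ _ P n K 1%:M) // => [|i j].
    by rewrite mul1mx mxtrace_mulC UU mxtrace_scalar.
  by have := iso i j; rewrite unlock.
pose G := [set t | forall y, 0 <= quad (M t - alpha%:M) y].
have mG : measurable G.
  apply: measurable_psd => i j; under eq_fun do rewrite mxE.
  by apply: measurable_funD => //; exact: measurable_cst.
(* The isometry [U] parametrizes [V], so injectivity on [V] becomes semidefiniteness of the
   compressed matrix, a measurable event; [H] plays the same role for the upper bound. *)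
have GE : [set t | forall x : 'cV[R]_n, x \in V ->
    alpha * norm2 x ^+ 2 <= norm2 ((sample Omega t)^T *m x) ^+ 2] = G.
  apply/seteqP; split=> t /= tG => [y|x /UV[y ->]].
    rewrite quadD quadN quad_scalar subr_ge0 -normU -normOU; apply: tG.
    by apply/UV; exists y.
  by have := tG y; rewrite quadD quadN quad_scalar subr_ge0 -normU -normOU.
pose H := [set t | forall y, 0 <= quad ((alpha + c / tau)%:M - M t) y].
have mH : measurable H.
  apply: measurable_psd => i j; under eq_fun do rewrite mxE [X in _ + X]mxE.
  by apply: measurable_funB => //; exact: measurable_cst.
rewrite (_ : mkset _ = G `&` H); last first.
  rewrite -GE; apply/seteqP; split=> t /= => [tGH|[tG tH] x xV].
    split=> [x /tGH/andP[]|y] //.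
    rewrite quadD quadN quad_scalar subr_ge0 -normU -normOU.
    by have /tGH/andP[] : U *m y \in V by apply/UV; exists y.
  rewrite tG //=; have /UV[y ->] := xV; have := tH y.
  by rewrite quadD quadN quad_scalar subr_ge0 -normU -normOU.
have trG t : \tr (M t - alpha%:M) = \tr (M t) - s%:R * alpha.
  by rewrite raddfB /= mxtrace_scalar mulr_natl.
have := inj V dV; rewrite GE => PG.
(* The constant [c] is chosen to make this an equality: [s - s * alpha * (1 - rho)] is
   [s * (1 - alpha + alpha * rho)]. *)
have EG : s%:R - s%:R * alpha * (1 - rho) <= c / tau * tau.
  by rewrite mulfVK ?gt_eqF // /c; lra.
have ctau0 : 0 <= c / tau by rewrite (le_trans _ ctau) // subr_ge0.
have mtrle : measurable [set t | \tr (M t) <= s%:R * alpha + c / tau].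
  by rewrite -[X in measurable X]setTI; exact: measurable_fun_le.
(* Testing the form on basis vectors shows that the diagonal of [M t - alpha%:M] is nonnegative. *)
have trGe t : G t -> s%:R * alpha <= \tr (M t).
  move=> Gt; rewrite -subr_ge0 -trG; apply: sumr_ge0 => i _.
  by have := Gt (delta_mx i 0); rewrite /quad trmx_delta -rowE -colE !mxE.
have trM0 t : 0 <= \tr (M t).
  apply: sumr_ge0 => i _.
  have := sqr_ge0 (norm2 ((sample Omega t)^T *m (U *m delta_mx i 0))).
  by rewrite normOU /quad trmx_delta -rowE -colE !mxE.
have := markov_on_event mG mtrM trM0 EtrM trGe.
move=> /(_ (c / tau) rho tau) /(_ _ ctau0 tau0 PG EG) /le_trans; apply.
  by rewrite mulr_ge0 // ltW.
apply: le_measure; rewrite ?inE; try exact: measurableI.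
move=> t [Gt /= trt]; split=> // y.
(* On [G] the trace bounds the form of [M t - alpha%:M], and the Markov event bounds this trace by
   [c / tau]; adding back [alpha] gives [H]. *)
have : quad (M t - alpha%:M) y <= c / tau * (y^T *m y) 0 0.
  apply: le_trans (psd_quad_le_trace Gt y) _.
  by rewrite trG ler_wpM2r ?trmx_mulmx_ge0 // lerBlDl.
by rewrite !quadD !quadN !quad_scalar lerBlDl subr_ge0 mulrDl.
Qed.
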